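(* Let $m,n$ be positive integers and let $\mathbf{A}$ be an $m\times n$ random Gaussian matrix. Let $\mathbf{W}\in\mathbb{R}^{n\times n}$ be a (possibly random) symmetric matrix with all eigenvalues in $[0,1]$ that is statistically independent of $\mathbf{A}$, and let $\boldsymbol{\xi}\in\mathbb{R}^n$ be a fixed vector. If $m\geqslant\operatorname{rank}(\mathbf{W})$ and $\boldsymbol{\xi}\in\mathcal{R}(\mathbf{W})$, then with probability $1$, $\boldsymbol{\xi}$ is the unique minimizer of the optimization problem $$\text{minimize } \ \boldsymbol{x}^\top(\mathbf{I}-\mathbf{W})\mathbf{W}^\dagger\boldsymbol{x}\quad\text{subject to}\quad \mathbf{A}\boldsymbol{x}=\mathbf{A}\boldsymbol{\xi},\ \ \boldsymbol{x}\in\mathcal{R}(\mathbf{W}).$$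
   Context: A random Gaussian matrix is an $m\times n$ matrix whose entries are i.i.d. Gaussian random variables with mean $0$ and variance $1/m$. $\mathcal{R}(\cdot)$ denotes range, $\mathbf{W}^\dagger$ is the Moore–Penrose pseudoinverse, and $\mathbf{I}$ is the $n\times n$ identity. The matrix $\mathbf{W}$ may be deterministic; if it is random, the stated conditions on $\mathbf{W}$ are assumed to hold almost surely. *)

(* Defs.v *)
From mathcomp Require Export all_boot all_order all_algebra.
From mathcomp Require Export all_classical all_reals all_analysis.

Set Implicit Arguments.
Unset Strict Implicit.
Unset Printing Implicit Defensive.

Import Order.TTheory GRing.Theory Num.Theory.
Import numFieldNormedType.Exports.

Local Open Scope classical_set_scope.
Local Open Scope ring_scope.

Section LinearAlgebra.
Variable R : realType.

Definition mxrange m n (M : 'M[R]_(m, n)) : set 'cV[R]_m :=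
  range (fun y : 'cV[R]_n => M *m y).

(* [pinvmx] of mxalgebra is only a generalized inverse, not the Moore-Penrose
   one, so the latter is defined here by the four Penrose equations;
   [penrose_exists] and [penrose_unique] show that [mp_pinv] is well defined. *)
Definition penrose m n (M : 'M[R]_(m, n)) (X : 'M[R]_(n, m)) : Prop :=
  [/\ M *m X *m M = M, X *m M *m X = X,
      (M *m X)^T = M *m X & (X *m M)^T = X *m M].

Definition mp_pinv m n (M : 'M[R]_(m, n)) : 'M[R]_(n, m) :=
  xget 0 [set X | penrose M X].

Lemma row_normsq_eq0 n (v : 'rV[R]_n) : v *m v^T = 0 -> v = 0.
Proof.
move=> /matrixP/(_ 0 0); rewrite !mxE => s0; apply/rowP => j; rewrite mxE.
have /psumr_eq0P/(_ s0)/(_ j isT)/eqP : 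
    forall i, true -> 0 <= v 0 i * v^T i 0.
  by move=> i _; rewrite mxE -expr2 sqr_ge0.
by rewrite mxE mulf_eq0 orbb => /eqP.
Qed.

Lemma gram_unitmx m n (B : 'M[R]_(m, n)) : row_free B -> B *m B^T \in unitmx.
Proof.
move=> fB; rewrite -row_free_unit; apply/inj_row_free => v vBB.
have vB : v *m B = 0.
  by apply: row_normsq_eq0; rewrite trmx_mul -mulmxA (mulmxA B) mulmxA vBB mul0mx.
by apply/eqP; rewrite -(mulmx_free_eq0 v fB) vB.
Qed.

Lemma penrose_full_rank m r n (C : 'M[R]_(m, r)) (B : 'M[R]_(r, n)) :
  row_free C^T -> row_free B ->
  penrose (C *m B) (B^T *m invmx (B *m B^T) *m invmx (C^T *m C) *m C^T).
Proof.
move=> /gram_unitmx; rewrite trmxK => uC /gram_unitmx uB.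
set M := C *m B; set G := invmx _; set H := invmx _; set X := _ *m C^T.
have GT : G^T = G by rewrite trmx_inv trmx_mul trmxK.
have HT : H^T = H by rewrite trmx_inv trmx_mul trmxK.
have MX : M *m X = C *m H *m C^T.
  rewrite /M /X !mulmxA -(mulmxA C B) -(mulmxA C (B *m B^T)).
  by rewrite mulmxV// mulmx1.
have XM : X *m M = B^T *m G *m B.
  rewrite /M /X !mulmxA -(mulmxA _ C^T C) -(mulmxA _ H (C^T *m C)).
  by rewrite mulVmx// mulmx1.
split.
- rewrite MX /M !mulmxA -(mulmxA _ C^T C) -(mulmxA _ H (C^T *m C)).
  by rewrite mulVmx// mulmx1.
- rewrite XM /X !mulmxA -(mulmxA _ B B^T) -(mulmxA _ G (B *m B^T)).
  by rewrite mulVmx// mulmx1.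
- by rewrite MX !trmx_mul trmxK HT mulmxA.
- by rewrite XM !trmx_mul trmxK GT mulmxA.
Qed.

Lemma penrose_exists m n (M : 'M[R]_(m, n)) : exists X, penrose M X.
Proof.
rewrite -(mulmx_base M); eexists; apply: penrose_full_rank.
  by rewrite /row_free mxrank_tr; exact: col_base_full.
exact: row_base_free.
Qed.

Lemma penrose_unique m n (M : 'M[R]_(m, n)) (X Y : 'M[R]_(n, m)) :
  penrose M X -> penrose M Y -> X = Y.
Proof.
move=> [MXM XMX MXT XMT] [MYM YMY MYT YMT].
have MXY : M *m X = M *m Y.
  rewrite -[LHS]MXT -[in LHS]MYM -(mulmxA (M *m Y)) trmx_mul MXT MYT.
  by rewrite mulmxA MXM.
have XYM : X *m M = Y *m M.
  rewrite -[LHS]XMT -[in LHS]MYM -(mulmxA M) mulmxA trmx_mul XMT YMT.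
  by rewrite -(mulmxA Y) (mulmxA M X) MXM.
by rewrite -XMX -mulmxA MXY mulmxA XYM YMY.
Qed.

Lemma mp_pinvP m n (M : 'M[R]_(m, n)) : penrose M (mp_pinv M).
Proof. by have [X MX] := penrose_exists M; exact: (xgetI 0 MX). Qed.

End LinearAlgebra.

Section Optimization.
Variables (R : realType) (X : Type).

Definition is_minimizer (f : X -> R) (S : set X) (x : X) : Prop :=
  S x /\ forall y, S y -> f x <= f y.

Definition is_unique_minimizer (f : X -> R) (S : set X) (x : X) : Prop :=
  is_minimizer f S x /\ forall y, is_minimizer f S y -> y = x.

End Optimization.

Section RandomMatrices.
Context (d : measure_display) (T : measurableType d) (R : realType).
Variable P : probability T R.

Definition realization m n (A : 'M[{RV P >-> R}]_(m, n)) (w : T) :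
    'M[R]_(m, n) :=
  map_mx (fun X : {RV P >-> R} => X w) A.

Definition mutually_independent (I : finType) (X : I -> {RV P >-> R}) : Prop :=
  forall (J : {set I}) (B : I -> set R), (forall i, measurable (B i)) ->
    P (\bigcap_(i in [set` J]) (X i @^-1` B i)) =
    (\prod_(i in J) P (X i @^-1` B i))%E.

(* The second parameter of [normal_prob] is the standard deviation. *)
Definition random_gaussian_mx m n (A : 'M[{RV P >-> R}]_(m, n)) : Prop :=
  mutually_independent (fun ij : 'I_m * 'I_n => A ij.1 ij.2) /\
  forall i j (B : set R), measurable B ->
    distribution P (A i j) B = normal_prob 0 (Num.sqrt (m%:R^-1)) B.

Definition sigma_mx m n (A : 'M[{RV P >-> R}]_(m, n)) : set (set T) :=
  <<s \bigcup_(ij in [set: 'I_m * 'I_n])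
        preimage_set_system setT (A ij.1 ij.2) measurable >>.

Definition independent_mx m n p q
    (A : 'M[{RV P >-> R}]_(m, n)) (W : 'M[{RV P >-> R}]_(p, q)) : Prop :=
  forall E F : set T, sigma_mx A E -> sigma_mx W F ->
    P (E `&` F) = (P E * P F)%E.

End RandomMatrices.

(* Main.v *)
(* Almost surely [A] is injective on the range of [W], so that [xi] is the only
   feasible point and the objective plays no role.

   Injectivity follows once some minor of [A *m W] of size [r = \rank W] does
   not vanish.  Start from a nonzero minor of [W] with columns [f]: it is the
   determinant of [S *m V], where [V] consists of the columns [f] of [W] and [S]
   is a row-selection matrix.  Replace the entries of [S] one at a time by
   entries of [A].  The determinant is affine in each entry, so if it is nonzero
   before a replacement, it vanishes for at most one new value; this value
   depends only on [W] and the other entries of [A], which are independent of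
   the new entry, and the latter has no atoms.  Hence by Fubini the determinant
   almost surely stays nonzero.  There are finitely many candidate minors. *)

From mathcomp Require Import measurable_realfun ring.
Require Import Defs.
Set Implicit Arguments.
Unset Strict Implicit.
Unset Printing Implicit Defensive.

Import Order.TTheory GRing.Theory Num.Theory.
Import numFieldNormedType.Exports.
Local Open Scope classical_set_scope.
Local Open Scope ring_scope.

(** * Ranks, minors, and determinants as functions of one entry *)

Section LinearAlgebra.
Variable F : fieldType.

(** The kernel of [B] lies in that of [A *m B], and the rank hypothesis makes their dimensions
    equal. Transposes appear because [kermx] is a left kernel. *)
Lemma mulmx_rank_ker m n p q (A : 'M[F]_(m, n)) (B : 'M[F]_(n, p))
    (u : 'M[F]_(p, q)) :
  (\rank B <= \rank (A *m B))%N -> A *m B *m u = 0 -> B *m u = 0.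
Proof.
move=> rkAB /(congr1 trmx) ABu0; apply: trmx_inj; rewrite trmx_mul trmx0.
apply/sub_kermxP; rewrite trmx_mul trmx0 in ABu0.
have/sub_kermxP/submx_trans := ABu0; apply.
have kS : (kermx B^T <= kermx (A *m B)^T)%MS.
  by apply/sub_kermxP; rewrite trmx_mul mulmxA mulmx_ker mul0mx.
rewrite -(geq_leqif (mxrank_leqif_sup kS)) !mxrank_ker !mxrank_tr.
exact: leq_sub2l.
Qed.

Lemma mxrank_mxsub m n p q (h : 'I_p -> 'I_m) (f : 'I_q -> 'I_n)
    (M : 'M[F]_(m, n)) :
  (\rank (mxsub h f M) <= \rank M)%N.
Proof.
have -> : mxsub h f M = rowsub h (colsub f M) by rewrite -mxsub_comp.
apply: leq_trans (mxrankS (rowsub_sub _ _)) _.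
by rewrite -[M in colsub f M]mulmx1 -mulmx_colsub mxrankM_maxl.
Qed.

(** Select a maximal free family of rows, then a maximal free family of columns of what remains. The
    selections are finite functions, so that only finitely many of them have to be considered
    later. *)
Lemma exists_minor m n (M : 'M[F]_(m, n)) :
  exists (g : {ffun 'I_(\rank M) -> 'I_m}) (f : {ffun 'I_(\rank M) -> 'I_n}),
    \det (mxsub g f M) != 0.
Proof.
have rf : row_full (rowsub (maxrankfun M) M)^T.
  by rewrite /row_full mxrank_tr; exact: maxrowsub_free.
exists (maxrankfun M), (fullrankfun rf).
have := fullrowsub_unit rf; rewrite unitmxE unitfE -det_tr.
suff -> : (rowsub (fullrankfun rf) (rowsub (maxrankfun M) M)^T)^T =
  mxsub (maxrankfun M) (fullrankfun rf) M by [].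
by apply/matrixP => i j; rewrite !mxE.
Qed.

Definition set_entry m n (M : 'M[F]_(m, n)) (p : 'I_m * 'I_n) (x : F) :=
  \matrix_(i, j) (if (i, j) == p then x else M i j).

(** Only row [p.1] depends on [x], and it is the combination of its versions at [0] and [1] with
    weights [1 - x] and [x]; multiplication by [V] preserves this, and the determinant is linear in
    that row. *)
Lemma det_set_entry m n (M : 'M[F]_(m, n)) (V : 'M[F]_(n, m)) p x :
  \det (set_entry M p x *m V) =
  (1 - x) * \det (set_entry M p 0 *m V) + x * \det (set_entry M p 1 *m V).
Proof.
case: p => i0 j0; apply: (@determinant_multilinear _ _ _ _ _ i0).
- rewrite !row_mul !scalemxAl -mulmxDl; congr (_ *m _).
  apply/rowP => j; rewrite !mxE xpair_eqE eqxx /=.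
  by case: ifP => _; rewrite ?mulr0 ?mulr1 ?add0r// -mulrDl subrK mul1r.
- apply/matrixP => i j; rewrite !mxE; apply: eq_bigr => k _.
  by rewrite !mxE xpair_eqE eq_sym (negPf (neq_lift _ _)).
- apply/matrixP => i j; rewrite !mxE; apply: eq_bigr => k _.
  by rewrite !mxE xpair_eqE eq_sym (negPf (neq_lift _ _)).
Qed.

(** An affine function with two distinct zeros vanishes everywhere, in particular at the current
    entry of [M], where its value is [\det (M *m V)]. *)
Lemma det_set_entry_inj m n (M : 'M[F]_(m, n)) (V : 'M[F]_(n, m)) p x y :
  \det (M *m V) != 0 -> \det (set_entry M p x *m V) = 0 ->
  \det (set_entry M p y *m V) = 0 -> x = y.
Proof.
move=> MV0 /eqP Mx /eqP My; apply: contraNeq MV0 => xy.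
have -> : M = set_entry M p (M p.1 p.2).
  by apply/matrixP => i j; rewrite mxE; case: eqP => // <-.
move: Mx My; rewrite !(det_set_entry _ _ _ x) !(det_set_entry _ _ _ y).
rewrite (det_set_entry _ _ _ (M _ _)).
move: (\det _) (\det _) => b a /eqP abx /eqP aby.
have /eqP : (x - y) * (b - a) = 0.
  transitivity (((1 - x) * a + x * b) - ((1 - y) * a + y * b)); first by ring.
  by rewrite abx aby subrr.
rewrite mulf_eq0 !subr_eq0 (negPf xy) /= => /eqP ba.
by move: abx; rewrite ba -mulrDl subrK mul1r => ->; rewrite !mulr0 addr0.
Qed.

End LinearAlgebra.

(** * Measurability of determinants and matrix products *)

Section Measurability.
Context d (T : measurableType d) (R : realType).

Lemma measurable_det k (M : T -> 'M[R]_k) :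
  (forall i j, measurable_fun setT (fun w => M w i j)) ->
  measurable_fun setT (fun w => \det (M w)).
Proof.
move=> mM; apply: measurable_sum => s; apply: measurable_funM => //.
by apply: measurable_prod => i _.
Qed.

Lemma measurable_mulmx m n p (A : T -> 'M[R]_(m, n)) (B : T -> 'M[R]_(n, p)) :
  (forall i j, measurable_fun setT (fun w => A w i j)) ->
  (forall i j, measurable_fun setT (fun w => B w i j)) ->
  forall i j, measurable_fun setT (fun w => (A w *m B w) i j).
Proof.
move=> mA mB i j; under eq_fun do rewrite mxE.
by apply: measurable_sum => k; apply: measurable_funM.
Qed.

End Measurability.

(** * Independence, pi-systems and Fubini *)

Section Independence.
Context d (T : measurableType d) (R : realType) (P : probability T R).

(** The set of values that [X] must avoid may vary with [w], provided that it does so measurably for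
    [<<s G>>], of which [X] is independent. Taking [w] itself as first coordinate avoids naming the
    variables that generate [G]. *)
Lemma indep_sections_null (X : {RV P >-> R}) (G : set (set T))
    (D : set (g_sigma_algebraType G * R)) :
  G `<=` measurable -> setI_closed G -> G setT ->
  (forall B E, measurable B -> G E ->
     P (X @^-1` B `&` E) = (P (X @^-1` B) * P E)%E) ->
  measurable D -> (forall w, P (X @^-1` xsection D w) = 0) ->
  P.-negligible [set w | D (w, X w)].
Proof.
move=> Gm GI GT indep mD D0.
have sGm : <<s G >> `<=` measurable.
  by apply: smallest_sub => //; exact: sigma_algebra_measurable.
have indepG B E : measurable B -> <<s G >> E ->
    P (X @^-1` B `&` E) = (P (X @^-1` B) * P E)%E.
  move=> mB sE.
  have mXB : measurable (X @^-1` B).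
    by rewrite -[X in measurable X]setTI; exact: measurable_funP.
  have XBfin : P (X @^-1` B) \is a fin_num by exact: fin_num_measure.
  (* As functions of [E], both sides are finite measures that agree on the pi-system [G], hence on
     the sigma-algebra generated by it. *)
  pose c : {nonneg R} := NngNum (fine_ge0 (measure_ge0 P (X @^-1` B))).
  have cE F : mscale c P F = (P (X @^-1` B) * P F)%E.
    by rewrite /mscale /= fineK.
  transitivity (mrestr P mXB E); first by rewrite /mrestr setIC.
  transitivity (mscale c P E); last exact: cE.
  apply: (g_sigma_algebra_measure_unique G Gm (fun=> setT)) sE => //.
  - by apply/seteqP; split => // w _; exists 0%N.
  - move=> F GF; transitivity (P (F `&` X @^-1` B)) => //.
    rewrite setIC indep//; exact/esym/cE.
  - by move=> _; rewrite /= /mrestr setTI -ge0_fin_numE.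
(* The joint law of [id : T -> (T, <<s G>>)] and [X] is a product measure. *)
pose idG : T -> g_sigma_algebraType G := id.
have midG : measurable_fun setT idG by move=> _ Y mY; rewrite setTI; exact: sGm.
have mpair : measurable_fun setT (fun w => (idG w, X w)).
  by apply: measurable_fun_pair => //; exact: measurable_funP.
pose id' : {mfun T >-> g_sigma_algebraType G} := mfun_Sub (mem_set midG).
pose pr : {mfun T >-> (g_sigma_algebraType G * R)%type} :=
  mfun_Sub (mem_set mpair).
exists (pr @^-1` D); split => //.
  by rewrite -[X in measurable X]setTI; exact: (measurable_funP pr).
have := @product_measure_unique _ _ _ _ R (distribution P id')
  (distribution P X) (distribution P pr).
move=> /(_ _ D mD) => DE.
transitivity (distribution P pr D) => //; rewrite -DE.
  by apply: integral0_eq => w _; exact: D0.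
move=> A B mA mB; rewrite muleC.
by transitivity (P (X @^-1` B `&` A)); [rewrite setIC | exact: indepG].
Qed.

(* The pi-system generated by the [X i] with [i != i0] together with [H]. *)
Definition cylinders (I : finType) (X : I -> {RV P >-> R}) (i0 : I)
    (H : set (set T)) : set (set T) :=
  [set F | exists2 B : I -> set R, (forall i, measurable (B i)) &
     exists2 E, H E &
       F = \bigcap_(i in [set` [set~ i0]%SET]) (X i @^-1` B i) `&` E].

Section Cylinders.
Variables (I : finType) (X : I -> {RV P >-> R}) (i0 : I) (H : set (set T)).
Hypotheses (Hm : H `<=` measurable) (HI : setI_closed H) (HT : H setT).
Let G := cylinders X i0 H.

Lemma measurable_preimages (J : {set I}) (B : I -> set R) :
  (forall i, measurable (B i)) ->
  measurable (\bigcap_(i in [set` J]) (X i @^-1` B i)).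
Proof.
move=> mB; apply: fin_bigcap_measurable => [|i _]; first exact: finite_finset.
by rewrite -[X in measurable X]setTI; exact: measurable_funP.
Qed.

Lemma cylinders_measurable : G `<=` measurable.
Proof.
move=> _ [B mB [E HE ->]]; apply: measurableI; last exact: Hm.
exact: measurable_preimages.
Qed.

Lemma cylinders_setI : setI_closed G.
Proof.
move=> _ _ [B mB [E HE ->]] [B' mB' [E' HE' ->]].
exists (fun i => B i `&` B' i) => [i|]; first exact: measurableI.
exists (E `&` E'); first exact: HI.
by rewrite setIACA -bigcapI.
Qed.

Lemma cylinders_sub : H `<=` G.
Proof.
move=> E HE; exists (fun=> setT) => //; exists E => //.
by apply/seteqP; split => [w Ew|w []//]; split.
Qed.

Lemma cylinders_setT : G setT.
Proof. exact: cylinders_sub. Qed.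

Lemma cylinders_preimage i B :
  i != i0 -> measurable B -> G (X i @^-1` B).
Proof.
move=> ii0 mB; exists (fun j => if j == i then B else setT) => [j|].
  by case: ifP.
exists setT => //; rewrite setIT; apply/seteqP; split => w.
  by move=> Bw j _ /=; case: eqP => // ->.
by move=> /(_ i) /=; rewrite eqxx !inE; exact.
Qed.

(** Adjoining the condition at [i0] turns a cylinder into an intersection over all of [I]. Mutual
    independence, used once for [I] and once for the complement of [i0], then splits off the factor
    of [i0]. *)
Lemma cylinders_indep : mutually_independent X ->
  (forall (J : {set I}) B E, (forall i, measurable (B i)) -> H E ->
     P (\bigcap_(i in [set` J]) (X i @^-1` B i) `&` E) =
     (P (\bigcap_(i in [set` J]) (X i @^-1` B i)) * P E)%E) ->
  forall B F, measurable B -> G F ->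
    P (X i0 @^-1` B `&` F) = (P (X i0 @^-1` B) * P F)%E.
Proof.
move=> Xind XH B0 _ mB0 [B mB [E HE ->]].
pose B' i := if i == i0 then B0 else B i.
have mB' i : measurable (B' i) by rewrite /B'; case: ifP.
have B'E : \bigcap_(i in [set` [set~ i0]%SET]) (X i @^-1` B i) =
    \bigcap_(i in [set` [set~ i0]%SET]) (X i @^-1` B' i).
  apply: eq_bigcapr => i; rewrite /= !inE /B'.
  by case: eqP.
rewrite XH// setIA B'E.
have -> : X i0 @^-1` B0 `&` \bigcap_(i in [set` [set~ i0]%SET]) (X i @^-1` B' i)
    = \bigcap_(i in [set` [set: I]%SET]) (X i @^-1` B' i).
  apply/seteqP; split => w.
    move=> [Bw Xw] i _; have [->|ii0] := eqVneq i i0.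
      by rewrite /B' eqxx.
    by apply: Xw; rewrite /= !inE.
  move=> Xw; split; last by move=> i _; apply: Xw; rewrite /= inE.
  by have := Xw i0; rewrite /B' /= eqxx inE; exact.
rewrite XH// Xind// Xind// (bigD1 i0) ?inE//= /B' eqxx muleA.
by congr (_ * _ * _)%E; apply: eq_bigl => i; rewrite !inE.
Qed.

End Cylinders.
End Independence.

(** * Exchanging the entries of a fixed matrix for random ones *)

Section RandomDeterminant.
Context d (T : measurableType d) (R : realType) (P : probability T R).
Variables (m n r : nat) (A : 'M[{RV P >-> R}]_(m, n)) (H : set (set T)).
Variables (V : T -> 'M[R]_(n, r)) (h : 'I_r -> 'I_m) (S : 'M[R]_(r, n)).
Hypotheses (Hm : H `<=` measurable) (HI : setI_closed H) (HT : H setT).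
Hypothesis A_indep : mutually_independent (fun ij : 'I_m * 'I_n => A ij.1 ij.2).
Hypothesis A_ac : forall i j, distribution P (A i j) `<< lebesgue_measure.
Hypothesis AH_indep : forall (J : {set 'I_m * 'I_n}) B E,
  (forall i, measurable (B i)) -> H E ->
  P (\bigcap_(ij in [set` J]) (A ij.1 ij.2 @^-1` B ij) `&` E) =
  (P (\bigcap_(ij in [set` J]) (A ij.1 ij.2 @^-1` B ij)) * P E)%E.
Hypothesis VH : forall i j B, measurable B -> H ((fun w => V w i j) @^-1` B).
Hypothesis h_inj : injective h.

(** Interpolates between [S], for the empty list, and the rows [h] of [A], for the list of all
    positions. *)
Definition mix (s : seq ('I_r * 'I_n)) (w : T) : 'M[R]_(r, n) :=
  \matrix_(i, j) if (i, j) \in s then A (h i) j w else S i j.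

Lemma mix_cons p s w : mix (p :: s) w = set_entry (mix s w) p (A (h p.1) p.2 w).
Proof.
by apply/matrixP => i j; rewrite !mxE inE; case: eqP => // <-.
Qed.

(** Everything in the determinant except the new entry is measurable for the cylinders [G] over the
    other entries of [A] and [H], so [indep_sections_null] applies to the set [D] of failures. *)
Lemma mix_step p s : p \notin s ->
  {ae P, forall w, \det (mix s w *m V w) != 0 ->
                   \det (mix (p :: s) w *m V w) != 0}.
Proof.
move=> ps; pose i0 := (h p.1, p.2).
pose X (ij : 'I_m * 'I_n) := A ij.1 ij.2.
pose G := cylinders X i0 H.
pose D : set (g_sigma_algebraType G * R) :=
  [set z | \det (mix s z.1 *m V z.1) != 0 /\
           \det (set_entry (mix s z.1) p z.2 *m V z.1) = 0].
have mG (f : T -> R) : (forall B, measurable B -> G (f @^-1` B)) ->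
    measurable_fun setT (fun z : g_sigma_algebraType G * R => f z.1).
  move=> fG.
  apply: (@measurableT_comp _ _ _ _ _ _ (f : g_sigma_algebraType G -> R)).
    by move=> _ B mB; rewrite setTI; apply: sub_sigma_algebra; exact: fG.
  exact: measurable_fst.
have mV i j : measurable_fun setT
    (fun z : g_sigma_algebraType G * R => V z.1 i j).
  apply: (mG (fun w => V w i j)) => B mB.
  by apply: cylinders_sub => //; exact: VH.
have mmix i j : measurable_fun setT
    (fun z : g_sigma_algebraType G * R => mix s z.1 i j).
  under eq_fun do rewrite mxE.
  have [ijs|_] := boolP ((i, j) \in s); last exact: measurable_cst.
  apply: (mG (A (h i) j)) => B mB.
  apply: (@cylinders_preimage _ _ _ _ _ X i0 H HT (h i, j)) => //.
  (* As [h] is injective, an entry of [A] already inserted at a position in [s] differs from the new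
     one. *)
  apply: contraNneq ps => -[/h_inj ip jp].
  by rewrite [p]surjective_pairing -ip -jp.
have mD : measurable D.
  have -> : D = (fun z => \det (mix s z.1 *m V z.1)) @^-1` [set~ 0] `&`
      (fun z => \det (set_entry (mix s z.1) p z.2 *m V z.1)) @^-1` [set 0].
    by apply/seteqP; split => z [/eqP ? ?]; split => //; apply/eqP.
  have m1 := measurable_det (measurable_mulmx mmix mV).
  have mset i j : measurable_fun setT
      (fun z : g_sigma_algebraType G * R => set_entry (mix s z.1) p z.2 i j).
    under eq_fun do rewrite mxE. have [_|_] := eqVneq (i, j) p;
      [exact: measurable_snd | exact: mmix].
  have m2 := measurable_det (measurable_mulmx mset mV).
  apply: measurableI; rewrite -[X in measurable X]setTI; last exact: m2.
  by apply: m1 => //; exact: measurableC.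
apply: (@negligibleS _ _ _ P [set w | D (w, X i0 w)]).
  move=> w /= /not_implyP[dw /negP]; rewrite negbK => /eqP dw0.
  by split => //=; rewrite -mix_cons.
apply: indep_sections_null mD _.
- exact: cylinders_measurable.
- exact: cylinders_setI.
- exact: cylinders_setT.
- exact: cylinders_indep.
move=> w.
(* A section of [D] has at most one point, by [det_set_entry_inj], and the law of the entry does not
   charge points, by absolute continuity. *)
have [[x Dx]|D0] := pselect (exists x, xsection D w x); last first.
  suff -> : xsection D w = set0 by rewrite preimage_set0 measure0.
  by rewrite -subset0 => x Dx; apply: D0; exists x.
suff -> : xsection D w = [set x].
  have x0 : lebesgue_measure.-null_set [set x].
    by apply/measure0_null_setP => //; exact: lebesgue_measure_set1.
  exact: (@A_ac (h p.1) p.2 [set x] x0 [set x]).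
apply/seteqP; split => [y|_ ->//].
move: Dx; rewrite /xsection /= !inE => -[Dw Dx] [_ Dy].
exact: (det_set_entry_inj Dw Dy Dx).
Qed.

Lemma mix_det_ae s :
  {ae P, forall w, \det (S *m V w) != 0 -> \det (mix s w *m V w) != 0}.
Proof.
elim: s => [|p s IH].
  apply: aeW => w; suff -> : mix [::] w = S by [].
  by apply/matrixP => i j; rewrite mxE.
have [ps|/mix_step] := boolP (p \in s).
  apply: filterS IH => w; suff -> : mix (p :: s) w = mix s w by [].
  by apply/matrixP => i j; rewrite !mxE inE; case: eqP => // ->; rewrite ps.
by apply: filterS2 IH => w Sw sw /Sw.
Qed.

Lemma rowsub_det_ae :
  {ae P, forall w, \det (S *m V w) != 0 ->
                   \det (rowsub h (realization A w) *m V w) != 0}.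
Proof.
apply: filterS (mix_det_ae (enum {: 'I_r * 'I_n})) => w.
suff -> : mix (enum {: 'I_r * 'I_n}) w = rowsub h (realization A w) by [].
by apply/matrixP => i j; rewrite !mxE mem_enum.
Qed.

End RandomDeterminant.

(** * Minors of the product of a Gaussian matrix and an independent matrix *)

Section GaussianMatrix.
Context d (T : measurableType d) (R : realType) (P : probability T R).

Lemma sigma_mx_measurable m n (A : 'M[{RV P >-> R}]_(m, n)) :
  sigma_mx A `<=` measurable.
Proof.
apply: smallest_sub; first exact: sigma_algebra_measurable.
by move=> _ [ij _ [B mB <-]]; exact: measurable_funP.
Qed.

Lemma sigma_mx_preimage m n (A : 'M[{RV P >-> R}]_(m, n)) i j B :
  measurable B -> sigma_mx A (A i j @^-1` B).
Proof.
move=> mB; apply: sub_sigma_algebra; exists (i, j) => //.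
by exists B => //; rewrite setTI.
Qed.

Lemma gaussian_ac m n (A : 'M[{RV P >-> R}]_(m, n)) i j :
  random_gaussian_mx A -> distribution P (A i j) `<< lebesgue_measure.
Proof.
move=> [_ AN] N N0 B mB BN.
by rewrite AN//; exact: (normal_prob_dominates 0 _ N0 mB BN).
Qed.

Lemma gaussian_minor_ae m n p q (A : 'M[{RV P >-> R}]_(m, n))
    (W : 'M[{RV P >-> R}]_(n, p)) (h : 'I_q -> 'I_m) (g : 'I_q -> 'I_n)
    (f : 'I_q -> 'I_p) :
  random_gaussian_mx A -> independent_mx A W -> injective h ->
  {ae P, forall w, \det (mxsub g f (realization W w)) != 0 ->
     \det (mxsub h f (realization A w *m realization W w)) != 0}.
Proof.
move=> GA AW h_inj.
have [A_indep _] := GA.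
(* Viewing the two generated sigma-algebras as measurable types gives their closure properties. *)
pose TW := g_sigma_algebraType (\bigcup_(ij in [set: 'I_n * 'I_p])
  preimage_set_system setT (W ij.1 ij.2) measurable).
pose TA := g_sigma_algebraType (\bigcup_(ij in [set: 'I_m * 'I_n])
  preimage_set_system setT (A ij.1 ij.2) measurable).
have WI : setI_closed (sigma_mx W) by exact: (@measurableI _ TW).
have WT : sigma_mx W setT by exact: (@measurableT _ TW).
have A_ac i j := gaussian_ac i j GA.
have AH_indep (J : {set 'I_m * 'I_n}) B E :
    (forall i, measurable (B i)) -> sigma_mx W E ->
    P (\bigcap_(ij in [set` J]) (A ij.1 ij.2 @^-1` B ij) `&` E) =
    (P (\bigcap_(ij in [set` J]) (A ij.1 ij.2 @^-1` B ij)) * P E)%E.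
  move=> mB WE; apply: AW => //.
  apply: (@fin_bigcap_measurable _ TA) => [|ij _]; first exact: finite_finset.
  exact: sigma_mx_preimage.
have VH i j B : measurable B ->
    sigma_mx W ((fun w => colsub f (realization W w) i j) @^-1` B).
  have -> : (fun w => colsub f (realization W w) i j) = W i (f j).
    by apply/funext => w; rewrite !mxE.
  exact: sigma_mx_preimage.
(* The starting matrix [rowsub g 1%:M] selects the rows [g], so that its product with the columns
   [f] of [W] is the given minor. *)
have := rowsub_det_ae (rowsub g 1%:M) (@sigma_mx_measurable _ _ W) WI WT A_indep
  A_ac AH_indep VH h_inj.
by apply: filterS => w; rewrite !mul_rowsub_mx mul1mx mulmx_colsub -!mxsub_comp.
Qed.

End GaussianMatrix.


(** * Uniqueness of the feasible point *)

Theorem theorem2p3 (R : realType) (d : measure_display) (T : measurableType d)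
    (P : probability T R) (m n : nat) (m_gt0 : (0 < m)%N) (n_gt0 : (0 < n)%N)
    (A : 'M[{RV P >-> R}]_(m, n)) (W : 'M[{RV P >-> R}]_n) (xi : 'cV[R]_n)
    (A_gaussian : random_gaussian_mx A)
    (W_sym : {ae P, forall w, (realization W w)^T = realization W w})
    (W_eig : {ae P, forall w, forall a : R,
        eigenvalue (realization W w) a -> 0 <= a <= 1})
    (AW_indep : independent_mx A W)
    (W_rank : {ae P, forall w, (\rank (realization W w) <= m)%N})
    (xi_range : {ae P, forall w, mxrange (realization W w) xi}) :
  {ae P, forall w,
    let Aw := realization A w in
    let Ww := realization W w in
    is_unique_minimizer
      (fun x : 'cV[R]_n => (x^T *m (1%:M - Ww) *m mp_pinv Ww *m x) 0 0)
      [set x : 'cV[R]_n | Aw *m x = Aw *m xi /\ mxrange Ww x]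
      xi}.
Proof.
(* The rank of [W] and its nonzero minor depend on [w], so the almost sure statement is made for all
   sizes [r <= m] and all [g], [f] at once: finitely many events. The first [r] rows of [A] serve as
   [h]. *)
have minors : {ae P, forall w, forall (r : 'I_m.+1)
    (g f : {ffun 'I_r -> 'I_n}), \det (mxsub g f (realization W w)) != 0 ->
    exists h : 'I_r -> 'I_m,
      \det (mxsub h f (realization A w *m realization W w)) != 0}.
  apply: filter_forall => r; apply: filter_forall => g.
  apply: filter_forall => f.
  have rm : (r <= m)%N by rewrite -ltnS.
  have h_inj : injective (widen_ord rm) by move=> i j /(congr1 val) /= /val_inj.
  have := gaussian_minor_ae g f A_gaussian AW_indep h_inj.
  apply: filterS => w /[apply].
  by exists (widen_ord rm).
apply: filterS3 W_rank xi_range minors => w rkW xiW minorsw /=.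
set Aw := realization A w; set Ww := realization W w.
have AW_free u : Aw *m Ww *m u = 0 -> Ww *m u = 0.
  apply: mulmx_rank_ker.
  have [g [f]] := exists_minor Ww.
  (* A nonzero minor of [Aw *m Ww] of size [\rank Ww] bounds the rank of the product from below. *)
  move=> /(minorsw (Ordinal (rkW : (_ < m.+1)%N)) g f)[h].
  rewrite -unitfE -unitmxE => /mxrank_unit/esym/eq_leq/leq_trans; apply.
  exact: mxrank_mxsub.
have feasible x : Aw *m x = Aw *m xi /\ mxrange Ww x -> x = xi.
  (* With [x = Ww *m y] and [xi = Ww *m z], apply [AW_free] to [y - z]. *)
  move=> [Ax [y _ yx]]; have [z _ zxi] := xiW.
  apply/eqP; rewrite -subr_eq0 -yx -zxi -mulmxBr; apply/eqP/AW_free.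
  by rewrite -mulmxA mulmxBr yx [Ww *m z]zxi mulmxBr Ax subrr.
split; last by move=> y [/feasible].
by split => // y /feasible ->.
Qed.
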